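(* A monotone graph class $\mathcal{G}$ has bounded underlying treewidth if and only if there is a graph $X$ such that no graph in $\mathcal{G}$ contains $X$ as a topological minor.
   Context: Graphs are finite, simple and undirected; $\mathrm{tw}$ denotes treewidth. A graph class is monotone if it is closed under isomorphism and under taking subgraphs. $X$ is a topological minor of $G$ if some subgraph of $G$ is isomorphic to a subdivision of $X$. For graphs $G,H$, an $H$-partition of $G$ is a partition $(V_x : x\in V(H))$ of $V(G)$ such that for every edge $vw$ of $G$ with $v\in V_x$, $w\in V_y$, either $x=y$ or $xy\in E(H)$; its width is $\max_x|V_x|$. $\mathrm{tpw}_c(G)$ is the minimum width of an $H$-partition of $G$ over all graphs $H$ with $\mathrm{tw}(H)\le c$. The underlying treewidth of $\mathcal{G}$ is the minimum $c\in\mathbb{N}_0$ for which there is a function $f$ with $\mathrm{tpw}_c(G)\le f(\mathrm{tw}(G))$ for all $G\in\mathcal{G}$; it is bounded if such a $c$ exists. *)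

(* Defs.v *)
From mathcomp Require Import all_boot.
Set Implicit Arguments. Unset Strict Implicit. Unset Printing Implicit Defensive.

(* A graph has vertex set 'I_gn; the raw relation is symmetrised and made
   irreflexive by [edge], so every record denotes a finite simple graph. *)
Record graph := Graph { gn : nat; gadj : rel 'I_gn }.

Definition edge (G : graph) : rel 'I_(gn G) :=
  fun u v => (u != v) && (gadj u v || gadj v u).

Definition iso (G H : graph) : Prop :=
  exists f : 'I_(gn G) -> 'I_(gn H),
    bijective f /\ forall u v, edge (f u) (f v) = edge u v.

Definition subgraph (H G : graph) : Prop :=
  exists f : 'I_(gn H) -> 'I_(gn G),
    injective f /\ forall u v, edge u v -> edge (f u) (f v).

Definition monotone (C : graph -> Prop) : Prop :=
  (forall G H, iso G H -> C G -> C H) /\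
  (forall G H, C G -> subgraph H G -> C H).

Definition acyclic (T : graph) : Prop :=
  ~ exists (x : 'I_(gn T)) (s : seq 'I_(gn T)),
      [/\ uniq (x :: s), 2 <= size s, path (@edge T) x s & edge (last x s) x].

Definition is_tree (T : graph) : Prop :=
  [/\ 0 < gn T, (forall a b : 'I_(gn T), connect (@edge T) a b) & acyclic T].

Definition tree_decomposition (G T : graph) (B : 'I_(gn T) -> {set 'I_(gn G)})
  : Prop :=
  [/\ is_tree T,
      (forall v, exists t, v \in B t),
      (forall v w, edge v w -> exists t, (v \in B t) && (w \in B t)) &
      (forall v t1 t2, v \in B t1 -> v \in B t2 ->
         connect (fun a b => [&& edge a b, v \in B a & v \in B b]) t1 t2)].

Definition tw_le (G : graph) (k : nat) : Prop :=
  exists (T : graph) (B : 'I_(gn T) -> {set 'I_(gn G)}),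
    tree_decomposition B /\ forall t, #|B t| <= k.+1.

Definition is_tw (G : graph) (k : nat) : Prop :=
  tw_le G k /\ forall j, tw_le G j -> k <= j.

(* the partition (V_x : x in V(H)) is given by p, with V_x = p^{-1}(x) *)
Definition H_partition (G H : graph) (p : 'I_(gn G) -> 'I_(gn H)) : Prop :=
  forall v w, edge v w -> p v = p w \/ edge (p v) (p w).

Definition partition_width_le (G H : graph) (p : 'I_(gn G) -> 'I_(gn H))
  (m : nat) : Prop :=
  forall x, #|[set v | p v == x]| <= m.

Definition tpw_le (c : nat) (G : graph) (m : nat) : Prop :=
  exists (H : graph) (p : 'I_(gn G) -> 'I_(gn H)),
    [/\ tw_le H c, H_partition p & partition_width_le p m].

Definition bounded_underlying_tw (C : graph -> Prop) : Prop :=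
  exists (c : nat) (f : nat -> nat),
    forall G, C G -> forall k, is_tw G k -> tpw_le c G (f k).

Definition nedge (G : graph) (a b : nat) : bool :=
  match @insub nat (fun i => i < gn G) 'I_(gn G) a,
        @insub nat (fun i => i < gn G) 'I_(gn G) b with
  | Some a', Some b' => edge a' b'
  | _, _ => false
  end.

(* subdivide the edge uv of G: new vertex gn G adjacent to u and v *)
Definition subdivide (G : graph) (u v : 'I_(gn G)) : graph :=
  @Graph (gn G).+1 (fun a b : 'I_(gn G).+1 =>
    let a := nat_of_ord a in let b := nat_of_ord b in
    let n := gn G in
    if (a < n) && (b < n) then
      nedge G a b && ~~ (((a == u) && (b == v)) || ((a == v) && (b == u)))
    else ((a == n) && ((b == u) || (b == v))) ||
         ((b == n) && ((a == u) || (a == v)))).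

Inductive subdivision (X : graph) : graph -> Prop :=
| subdivision_refl : subdivision X X
| subdivision_step (S : graph) (u v : 'I_(gn S)) :
    subdivision X S -> edge u v -> subdivision X (subdivide u v).

Definition top_minor (X G : graph) : Prop :=
  exists S, subdivision X S /\ subgraph S G.

(* Main.v *)
Require Import Defs.
From mathcomp Require Import all_boot zify.
Set Implicit Arguments. Unset Strict Implicit. Unset Printing Implicit Defensive.

(** If topological minors of [X] are excluded, Erdos-Posa on connected subgraphs
    gives, inside a component [D] with few neighbours among the placed vertices,
    a few bags whose removal leaves only connected sets that see fewer than [|X|] of
    those neighbours: otherwise many disjoint connected sets see the same [|X|]
    vertices, which become the branch vertices of [X].  Closing these bags under
    lowest common ancestors bounds the attachment of each remaining component to
    the new part, so parts can be added one by one and the quotient has treewidth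
    at most [|X|].

    Conversely let [X] be the closure of a deep tree of large degree.  Every
    subdivision of [X] has treewidth at most the depth.  In a partition of bounded
    width of a subdivision, a root-to-leaf walk picks [2c+3] vertices in distinct
    parts, and every set of [c+1] parts misses all the subdivided edges from some
    child of the last vertex to the chosen ones; hence no bag of [c+1] parts
    separates the chosen parts in a balanced way, and the quotient has treewidth
    more than [c]. *)

(** * Connected vertex sets *)

Lemma edge_sym (G : graph) (u v : 'I_(gn G)) : edge u v = edge v u.
Proof. by rewrite /edge eq_sym orbC. Qed.

Lemma edge_irrefl (G : graph) (u : 'I_(gn G)) : edge u u = false.
Proof. by rewrite /edge eqxx. Qed.

Definition redge (G : graph) (A : {set 'I_(gn G)}) : rel 'I_(gn G) :=
  fun a b => [&& edge a b, a \in A & b \in A].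

(** The empty set counts as connected; nonemptiness is asked for separately where it matters. *)
Definition conn (G : graph) (A : {set 'I_(gn G)}) : bool :=
  [forall a in A, forall b in A, connect (redge A) a b].

Lemma connP (G : graph) (A : {set 'I_(gn G)}) :
  reflect {in A &, forall a b, connect (redge A) a b} (conn A).
Proof.
apply: (iffP forall_inP) => [cA a b aA bA|cA a aA].
  exact: (forall_inP (cA a aA)).
by apply/forall_inP => b; apply: cA.
Qed.

Lemma redge_sym (G : graph) (A : {set 'I_(gn G)}) : symmetric (redge A).
Proof. by move=> a b; rewrite /redge edge_sym [(b \in A) && _]andbC. Qed.

Lemma redge_csym (G : graph) (A : {set 'I_(gn G)}) : connect_sym (redge A).
Proof. exact/sym_connect_sym/redge_sym. Qed.

Lemma redgeS (G : graph) (A A' : {set 'I_(gn G)}) :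
  A \subset A' -> subrel (connect (redge A)) (connect (redge A')).
Proof.
move=> sAA; apply: connect_sub => a b /and3P [e aA bA]; apply: connect1.
by rewrite /redge e !(subsetP sAA).
Qed.

Lemma redge_in (G : graph) (A : {set 'I_(gn G)}) a b :
  connect (redge A) a b -> a \in A -> b \in A.
Proof.
by move=> c; rewrite (closed_connect _ c) // => x y /and3P [_ -> ->].
Qed.

Lemma conn1 (G : graph) (v : 'I_(gn G)) : conn [set v].
Proof. by apply/connP => a b /set1P -> /set1P ->. Qed.

Lemma conn_component (G : graph) (A : {set 'I_(gn G)}) a :
  a \in A -> conn [set b | connect (redge A) a b].
Proof.
move=> aA; set K := [set _ | _].
have Kp b : connect (redge A) a b -> connect (redge K) a b.
  case/connectP => s ps ->; elim/last_ind: s ps => //= s y IH.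
  rewrite rcons_path last_rcons => /andP [ps e].
  apply: connect_trans (IH ps) _; apply: connect1.
  have al : connect (redge A) a (last a s) by apply/connectP; exists s.
  rewrite /redge !inE al (connect_trans al (connect1 e)).
  by case/andP: e => ->.
apply/connP => x y; rewrite !inE => /Kp ax /Kp ay.
by apply: connect_trans ay; rewrite redge_csym.
Qed.

Lemma conn_const (G : graph) (A : {set 'I_(gn G)}) (P : pred 'I_(gn G)) a b :
  conn A -> {in A &, forall x y, edge x y -> P x -> P y} ->
  a \in A -> b \in A -> P a -> P b.
Proof.
move=> /connP cA HP aA bA Pa.
have := cA a b aA bA; case/connectP => s ps ->.
elim/last_ind: s ps => //= s y IH.
rewrite rcons_path last_rcons => /andP [/IH Pl /and3P [e lA yA]].
exact: HP e Pl.
Qed.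

(** * Ancestors and lowest common ancestors in a tree numbered with parents first *)

Section Ancestors.

Variable par : nat -> nat.
Hypothesis parP : forall i, par i <= i.-1.

(** The iterates of [par] from [i] reach the root [0] within [i] steps, so the first [i.+1] of them
    are all the ancestors and the relation is decidable. *)
Definition anc (z i : nat) : bool := z \in traject par i i.+1.

Lemma iter_par_le j i : iter j par i <= i - j.
Proof. by elim: j => [|j IH] /=; [lia | have := parP (iter j par i); lia]. Qed.

Lemma ancP z i : reflect (exists j, iter j par i = z) (anc z i).
Proof.
apply: (iffP trajectP) => [[j _ ->]|[j <-]]; first by exists j.
case: (leqP j i) => ji; first by exists j.
exists i => //; have := iter_par_le j i; have := iter_par_le i i.
by rewrite subnn (eqP (ltnW ji)) !leqn0 => /eqP -> /eqP ->.
Qed.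

Lemma anc_refl i : anc i i.
Proof. by apply/ancP; exists 0. Qed.

Lemma anc0 i : anc 0 i.
Proof. by apply/ancP; exists i; have := iter_par_le i i; lia. Qed.

Lemma anc_par i : anc (par i) i.
Proof. by apply/ancP; exists 1. Qed.

Lemma anc_trans y x z : anc x y -> anc y z -> anc x z.
Proof.
by move=> /ancP [j <-] /ancP [l <-]; apply/ancP; exists (j + l); rewrite iterD.
Qed.

Lemma anc_le z i : anc z i -> z <= i.
Proof. by case/ancP => j <-; have := iter_par_le j i; lia. Qed.

Lemma anc_parE z i : anc z i -> z = i \/ anc z (par i).
Proof.
case/ancP => -[|j] <-; first by left.
by right; apply/ancP; exists j; rewrite iterSr.
Qed.

Lemma anc_chain x y i : anc x i -> anc y i -> x <= y -> anc x y.
Proof.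
move=> ax ay; case/ancP: (ax) => j jx; case/ancP: (ay) => l ly xy.
case: (leqP l j) => lj.
  by apply/ancP; exists (j - l); rewrite -ly -iterD subnK.
have: anc y x by apply/ancP; exists (l - j); rewrite -jx -iterD subnK // ltnW.
by move/anc_le => yx; have -> : x = y by [lia]; exact: anc_refl.
Qed.

(** Common ancestors lie on a single path to the root, along which numbers decrease, so the largest
    number belongs to the lowest one. *)
Definition lca a b : nat := \max_(x < a.+1 | anc x a && anc x b) x.

Lemma lcaP a b : anc (lca a b) a && anc (lca a b) b.
Proof.
rewrite /lca; have P0 : anc (@ord0 a) a && anc (@ord0 a) b by rewrite !anc0.
by rewrite (bigmax_eq_arg ord0) //; case: arg_maxnP.
Qed.

Lemma lca_max a b x : anc x a -> anc x b -> anc x (lca a b).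
Proof.
move=> xa xb; have /andP [la lb] := lcaP a b.
apply: (anc_chain xa la).
have xa' : x < a.+1 by exact: (anc_le xa).
by apply: (leq_bigmax_cond (F := @nat_of_ord _) (Ordinal xa')); rewrite /= xa xb.
Qed.

End Ancestors.

(** * Rooted tree decompositions: separation, packing and covering, balanced bags *)

(* Tree decompositions of width at most [k], with the nodes of the tree
   numbered so that the parent of a node precedes it (the root is [0], and
   [par 0 = 0]); [tp v] is the topmost node whose bag contains [v]. *)
Record rtd (G : graph) (m : nat) (par : nat -> nat)
    (B : nat -> {set 'I_(gn G)}) (tp : 'I_(gn G) -> nat) (k : nat) : Prop := {
  rtd_par : forall i, par i <= i.-1;
  rtd_lt : forall i v, v \in B i -> i < m;
  rtd_tp : forall v, v \in B (tp v);
  rtd_edge : forall v w, edge v w -> exists i, (v \in B i) && (w \in B i);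
  rtd_up : forall v i, v \in B i -> i = tp v \/ 0 < i /\ v \in B (par i);
  rtd_size : forall i, #|B i| <= k.+1 }.

Section RootedDecomposition.

Variables (G : graph) (m : nat) (par : nat -> nat).
Variables (B : nat -> {set 'I_(gn G)}) (tp : 'I_(gn G) -> nat) (k : nat).
Hypothesis R : rtd m par B tp k.

Let parP := rtd_par R.
Local Notation anc := (anc par).

(** The tree edge above [z] splits the bags into two sides. If no vertex of [A] lay in both bags at
    its ends, all bags of a vertex of [A] would be on one side, and, since adjacent vertices share a
    bag, this side would be the same for all of [A]. *)
Lemma crossing (A : {set 'I_(gn G)}) z a b i j :
  conn A -> a \in A -> b \in A -> a \in B i -> b \in B j ->
  anc z i -> ~~ anc z j ->
  exists2 v, v \in A & (v \in B z) && (v \in B (par z)).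
Proof.
move=> cA aA bA ai bj zi nzj.
case: (pickP [pred v in A | (v \in B z) && (v \in B (par z))]) => [v /andP [vA vz]|nov].
  by exists v.
have z_gt0 : 0 < z by case: (z) nzj => //; rewrite anc0.
have side v n : v \in A -> v \in B n -> anc z n = anc z (tp v).
  move=> vA; elim/ltn_ind: n => n IH vn.
  case: (rtd_up R vn) => [->//|[n0 vp]].
  rewrite -(IH (par n)) //; last by have := parP n; lia.
  apply/idP/idP => [/anc_parE|zp]; last exact: (anc_trans parP zp (anc_par parP _)).
  case=> // zn; have := nov v; rewrite inE /= vA zn vn; subst z.
  by rewrite vp.
suff: anc z (tp b) by rewrite -(side b j) ?(negbTE nzj).
apply: (conn_const (P := fun v => anc z (tp v)) cA _ aA bA).
  move=> x y xA yA /(rtd_edge R) [n /andP [xn yn]].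
  by rewrite -(side x n) // -(side y n).
by rewrite -(side a i).
Qed.

Definition touches (A : {set 'I_(gn G)}) i : bool := [exists a in A, a \in B i].

Lemma touches_ex (A : {set 'I_(gn G)}) : A != set0 -> exists i, touches A i.
Proof.
by case/set0Pn => a aA; exists (tp a); apply/exists_inP; exists a; rewrite ?(rtd_tp R).
Qed.

(** The least-numbered touched node works: if some touched node were not below it, [crossing] would
    make its parent touched as well. *)
Lemma top_node (A : {set 'I_(gn G)}) : conn A -> A != set0 ->
  exists t, touches A t /\ forall j, touches A j -> anc t j.
Proof.
move=> cA /touches_ex exA; exists (ex_minn exA).
case: ex_minnP => t tA tmin; split=> // j jA; apply: contraT => ntj.
case/exists_inP: (tA) => a aA at_; case/exists_inP: (jA) => b bA bj.
have [v vA /andP [_ vp]] := crossing cA aA bA at_ bj (anc_refl parP t) ntj.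
have := tmin (par t); have -> : touches A (par t) by apply/exists_inP; exists v.
move/(_ isT); have := parP t; case: (posnP t) ntj => [->|]; last lia.
by rewrite anc0.
Qed.

(* Repeatedly take a member whose topmost node [t] comes last in the numbering:
   every member avoiding the bag of [t] is disjoint from it. *)
Lemma erdos_posa (F : pred {set 'I_(gn G)}) N :
  (forall A, F A -> conn A /\ A != set0) ->
  (exists s : seq {set 'I_(gn G)}, [/\ size s = N, all F s &
     pairwise (fun A A' : {set 'I_(gn G)} => [disjoint A & A']) s]) \/
  (exists M : seq nat, size M < N /\ forall A, F A -> has (touches A) M).
Proof.
elim: N F => [|N IH] F cF; first by left; exists [::].
have [A0 FA0|F0] := pickP F; last first.
  by right; exists [::]; split => // A; rewrite F0.
pose top t A := F A && touches A t && [forall j : 'I_m, touches A j ==> anc t j].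
have topE A t : top t A -> [/\ F A, touches A t & forall j, touches A j -> anc t j].
  case/andP => /andP [FA tA] /forallP H; split=> // j jA.
  case/exists_inP: (jA) => a aA /(rtd_lt R) jm.
  by move: (implyP (H (Ordinal jm)) jA).
have top_ex A : F A -> exists t, top t A.
  move=> FA; have [cA nA] := cF _ FA; have [t [tA tj]] := top_node cA nA.
  by exists t; rewrite /top FA tA; apply/forallP => j; apply/implyP/tj.
pose P t := [exists A, top t A].
have exP : exists t, P t.
  by have [t tA] := top_ex _ FA0; exists t; apply/existsP; exists A0.
have ubP t : P t -> t <= m.
  case/existsP => A /topE [_ /exists_inP [a _ /(rtd_lt R) tm] _].
  exact: ltnW.
case: (ex_maxnP exP ubP) => t /existsP [A /topE [FA tA tj]] tmax.
pose F' := [pred A' | F A' && ~~ touches A' t].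
case: (IH F') => [A' /andP [FA' _]|[s [ss Fs ds]]|[M [sM hM]]]; first exact: cF.
- left; exists (A :: s); split=> /=; first by rewrite ss.
    by rewrite FA; apply: sub_all Fs => A' /andP [].
  rewrite ds andbT; apply/allP => A' /(allP Fs) /andP [FA' nA't].
  (* A vertex [x] common to [A] and [A'] has its bags below [t], while the top [t'] of [A'] is not
     below [t]; so [A'] crosses at [t] and touches its bag. *)
  rewrite disjoint_subset; apply/subsetP => x xA; apply/negP => xA'.
  have [t' tt'] := top_ex _ FA'; have [_ t'A' t'j] := topE _ _ tt'.
  have t't : t' <= t by apply: tmax; apply/existsP; exists A'.
  have ntt' : ~~ anc t t'.
    apply: contra nA't => /anc_le => /(_ parP) tlt'.
    by have -> : t = t' by lia.
  case/exists_inP: (t'A') => b bA' bt'.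
  have ttx : anc t (tp x) by apply: tj; apply/exists_inP; exists x; rewrite ?(rtd_tp R).
  have [cA' _] := cF _ FA'.
  have [v vA' /andP [vt _]] := crossing cA' xA' bA' (rtd_tp R x) bt' ttx ntt'.
  by case/negP: nA't; apply/exists_inP; exists v.
- right; exists (t :: M); split=> // A1 FA1 /=.
  case t1: (touches A1 t) => //=; apply: hM.
  by rewrite /= FA1 t1.
Qed.

(** Two disjoint sets cannot both contain [k.+2] of at most [k.*2.+3] vertices, so [erdos_posa] with
    [N = 2] leaves at most one node, whose bag meets all the sets in question. *)
Lemma balanced_bag (Q : {set 'I_(gn G)}) : #|Q| <= k.*2.+3 ->
  exists Y : {set 'I_(gn G)}, #|Y| <= k.+1 /\
    forall C, conn C -> k.+2 <= #|C :&: Q| -> ~~ [disjoint C & Y].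
Proof.
move=> Qs; pose F := [pred C | conn C && (k.+2 <= #|C :&: Q|)].
case: (@erdos_posa F 2) => [C /andP [cC qC]|[s [sz FC dC]]|].
- by split=> //; apply: contraTneq qC => ->; rewrite set0I cards0.
- case: s sz FC dC => [|C1 [|C2 [|//]]] //= _ FC dC; move: dC FC => /andP [/andP [d12 _] _].
  case/and3P=> /andP [_ q1] /andP [_ q2] _.
  have: #|(C1 :&: Q) :|: (C2 :&: Q)| <= #|Q| by rewrite -setIUl subset_leq_card ?subsetIr.
  rewrite cardsU (_ : _ :&: _ :&: _ = set0) ?cards0.
    move=> sQ; exfalso; move: Qs sQ q1 q2; rewrite -addnn.
    by move: #|C1 :&: Q| #|C2 :&: Q| #|Q|; lia.
  apply/setP => x; rewrite !inE; case x1: (x \in C1); rewrite //= (disjointFr d12) //.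
  by rewrite andbF.
case=> M [szM hM]; case: M szM hM => [|y [|? ?]] //= _ hM.
- exists set0; split; rewrite ?cards0 // => C cC qC.
  by have := hM C; rewrite /= cC qC => /(_ isT).
exists (B y); split=> [|C cC qC]; first exact: (rtd_size R).
have := hM C; rewrite /= cC qC orbF => /(_ isT) /exists_inP [v vC vy].
by apply/negP => /disjointFr - /(_ _ vC); rewrite vy.
Qed.

(* The nodes are closed under lowest common ancestors, so that the region of
   the tree containing the nodes that touch [A] is bordered by at most two
   nodes of the closure: the parent of its top, and one below it. *)
Lemma lca_closure (M : seq nat) : exists M' : seq nat,
  [/\ size M' = size M * size M, {subset M <= M'} &
    forall A : {set 'I_(gn G)}, conn A -> A != set0 ->
      (forall i, i \in M' -> ~~ touches A i) ->
      exists m1 m2, forall v i, (exists2 a, a \in A & edge v a) ->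
        i \in M' -> v \in B i -> v \in B m1 :|: B m2].
Proof.
exists [seq lca par a b | a <- M, b <- M]; split; first by rewrite size_allpairs.
  move=> a aM; apply/allpairsP; exists (a, a); split=> //=.
  have /andP [la _] := lcaP parP a a.
  have := lca_max parP (anc_refl parP a) (anc_refl parP a).
  by move/(anc_le parP); move/(anc_le parP): la; lia.
set M' := [seq _ | _ <- _, _ <- _] => A cA nA offA.
have [t tA] := touches_ex nA.
(* The closure nodes below [r], if there are any, have a topmost one: fix [a] in [M] below [r] and
   take the highest [lca par a b] over all [b] in [M] below [r]. *)
have glb r : has (anc r) M' -> exists2 m2, m2 \in M' &
    anc r m2 /\ forall i, i \in M' -> anc r i -> anc m2 i.
  case/hasP => _ /allpairsP [[a b] /= [aM bM ->]] ral.
  have [/= la lb] := andP (lcaP parP a b).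
  have ra := anc_trans parP ral la.
  pose P x := has (fun b => anc r b && (lca par a b == x)) M.
  have exP : exists x, P x by exists (lca par a a); apply/hasP; exists a; rewrite ?ra ?eqxx.
  case: (ex_minnP exP) => m2 /hasP [c cM /andP [rc /eqP m2E]] m2min.
  have m2b d : d \in M -> anc r d -> anc m2 d.
    move=> dM rd; have [/= l1 l2] := andP (lcaP parP a d).
    apply: (fun h => anc_trans parP h l2); have [l3 _] := andP (lcaP parP a c).
    rewrite m2E in l3; apply: (anc_chain parP l3 l1).
    by apply: m2min; apply/hasP; exists d; rewrite ?rd ?eqxx.
  exists m2; first by rewrite -m2E; apply/allpairsP; exists (a, c).
  split=> [|_ /allpairsP [[d e] /= [dM eM ->]] rde]; first by rewrite -m2E lca_max.
  have [/= l1 l2] := andP (lcaP parP d e).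
  by apply: lca_max => //; apply: m2b => //; exact: (anc_trans parP rde).
(* The least such [r] is the top of the region of [t]: the path from [t] up to [r] contains no
   closure node, and [par r] is one unless [r] is the root. *)
have exr : exists r, anc r t && all (fun x => anc r x ==> ~~ anc x t) M'.
  exists t; rewrite (anc_refl parP) /=; apply/allP => x xM'; apply/implyP => tx.
  apply: contraTN tA => xt; rewrite (_ : t = x) ?offA //.
  by have := anc_le parP tx; have := anc_le parP xt; lia.
case: (ex_minnP exr) => r /andP [rt /allP rM'] rmin.
have parr : 0 < r -> par r \in M'.
  move=> r0; apply: contraT => nprM; have := rmin (par r).
  rewrite (anc_trans parP (anc_par parP r) rt) /=.
  suff -> : all (fun x => anc (par r) x ==> ~~ anc x t) M'.
    by move/(_ isT); have := parP r; lia.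
  apply/allP => x xM'; apply/implyP => prx; apply/negP => xt.
  have := rM' x xM'; rewrite xt implybF => nrx.
  case: (leqP r x) => rx; first by rewrite (anc_chain parP rt xt) in nrx.
  have := anc_chain parP xt rt (ltnW rx); case/(anc_parE parP) => [xr|xpr]; first lia.
  have xE : x = par r by have := anc_le parP xpr; have := anc_le parP prx; lia.
  by rewrite -xE xM' in nprM.
case/exists_inP: (tA) => a0 a0A a0t.
have [m2 m2P] : exists m2, forall i, i \in M' -> anc r i ->
    [/\ m2 \in M', anc r m2 & anc m2 i].
  case h: (has (anc r) M').
    by have [m2 m2M [rm2 m2i]] := glb r h; exists m2 => i iM' ri; split=> //; apply: m2i.
  (* With no closure node below [r] the value [0] is arbitrary. *)
  by exists 0 => i iM' ri; case/negP: (negbT h); apply/hasP; exists i.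
exists (par r), m2 => v i [a aA va] iM' vi.
have [j /andP [vj aj]] := rtd_edge R va.
have rj : anc r j.
  apply: contraT => nrj.
  have [w wA /andP [_ wp]] := crossing cA a0A aA a0t aj rt nrj.
  have r0 : 0 < r by case: (r) nrj => //; rewrite anc0.
  by have /negP [] := offA _ (parr r0); apply/exists_inP; exists w.
(* The bag [j] shared by [v] and [a] is inside the region. The bag [i] is outside it, either below
   [m2] or not below [r], so [v] itself crosses at [m2] or at [r]. *)
case ri: (anc r i).
  have [m2M rm2 m2i] := m2P i iM' ri.
  have nm2j : ~~ anc m2 j.
    apply/negP => m2j; have nm2t := implyP (rM' _ m2M) rm2.
    have [w wA /andP [wm _]] := crossing cA aA a0A aj a0t m2j nm2t.
    by have /negP [] := offA _ m2M; apply/exists_inP; exists w.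
  have [w /set1P -> /andP [wm _]] :=
    crossing (conn1 v) (set11 v) (set11 v) vi vj m2i nm2j.
  by rewrite inE wm orbT.
have [w /set1P -> /andP [_ wp]] :=
  crossing (conn1 v) (set11 v) (set11 v) vj vi rj (negbT ri).
by rewrite inE wp.
Qed.

End RootedDecomposition.

(** * Passing between tree decompositions and rooted ones *)

(** A connected set of tree vertices is grown one vertex at a time, starting from [x0]; the new
    vertex has a neighbour in the set because the tree is connected, and only one because it is
    acyclic. *)
Lemma tree_numbering (T : graph) (x0 : 'I_(gn T)) : is_tree T ->
  exists s : seq 'I_(gn T), [/\ uniq s, (forall x, x \in s) &
    forall i, 0 < i < size s -> exists2 j, j < i &
      forall l, l < i -> edge (nth x0 s l) (nth x0 s i) = (l == j)].
Proof.
case=> T0 cT aT.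
have H l : l < gn T -> exists s : seq 'I_(gn T), [/\ size s = l.+1, uniq s,
    conn [set x in s] &
    forall i, 0 < i < size s -> exists2 j, j < i &
      forall l, l < i -> edge (nth x0 s l) (nth x0 s i) = (l == j)].
  elim: l => [_|l IH ln].
    exists [:: x0]; split=> // [|[|i] //].
    by apply/connP => a b; rewrite !inE => /eqP -> /eqP ->.
  have [s [ss us cs Hs]] := IH (ltnW ln).
  have [z zs] : exists z, z \notin s.
    apply/existsP; apply: contraLR ln => /existsPn all_s.
    rewrite -leqNgt -ss -(card_uniqP us) -{1}(card_ord (gn T)).
    by apply: subset_leq_card; apply/subsetP => z _; have := all_s z; rewrite negbK.
  have [a as_] : exists a, a \in s by case: (s) ss => // a s' _; exists a; rewrite mem_head.
  have [x [y [xs ys exy]]] : exists x y, [/\ x \in s, y \notin s & edge x y].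
    case: (pickP (fun p : 'I_(gn T) * 'I_(gn T) =>
        [&& p.1 \in s, p.2 \notin s & edge p.1 p.2])) => [[x y] /and3P [? ? ?]|no].
      by exists x, y.
    have cl : closed (@edge T) (mem s).
      move=> x y exy; have := no (x, y); have := no (y, x).
      by rewrite /= [edge y x]edge_sym exy !andbT /in_mem /=; do 2!case: (mem_seq _ _).
    by rewrite -(closed_connect cl (cT a z)) /= as_ in zs.
  (* A second neighbour [x'] would close a cycle: [y], then a simple path from [x] to [x'] inside
     [s]. *)
  have uniq_nb x' : x' \in s -> edge x' y -> x' = x.
    move=> x's ex'y; apply/eqP/negPn/negP => x'x; apply: aT.
    have /connectP [p pp px'] : connect (redge [set x in s]) x x'.
      by move/connP: cs; apply; rewrite inE.
    case/shortenP: pp px' => q pq uq _ qx'.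
    have sub_e : subrel (redge [set x in s]) (@edge T) by move=> ? ? /andP [].
    exists y, (x :: q); split.
    - rewrite cons_uniq uq andbT inE negb_or; apply/andP; split.
        by apply: contraNneq ys => ->.
      apply: contra ys => yq; case/splitPr: yq pq => q1 q2.
      by rewrite cat_path /= => /andP [_ /andP [/and3P [_ _]]]; rewrite inE.
    - by case: q qx' {pq uq} => //= xx; rewrite xx eqxx in x'x.
    - by rewrite /= edge_sym exy (sub_path sub_e).
    - by rewrite /= -qx'.
  exists (rcons s y); split.
  - by rewrite size_rcons ss.
  - by rewrite rcons_uniq ys.
  - have sS : [set x in s] \subset [set x in rcons s y].
      by apply/subsetP => b; rewrite !inE mem_rcons inE => ->; rewrite orbT.
    have toy b : b \in rcons s y -> connect (redge [set x in rcons s y]) b x.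
      rewrite mem_rcons inE => /predU1P [->|bs].
        apply: connect1; rewrite /redge edge_sym exy !inE !mem_rcons !inE eqxx xs.
        by rewrite orbT.
      by apply: (redgeS sS); move/connP: cs; apply; rewrite inE.
    apply/connP => b c; rewrite !inE => /toy bx /toy cx.
    by apply: connect_trans bx _; rewrite redge_csym.
  - move=> i; rewrite size_rcons ltnS => /andP [i0].
    rewrite leq_eqVlt => /predU1P [->|is_].
      exists (index x s); first by rewrite index_mem.
      move=> l' ls; rewrite !nth_rcons ls ltnn eqxx.
      apply/idP/eqP => [e|->]; last by rewrite nth_index.
      by rewrite -(uniq_nb _ (mem_nth x0 ls) e) index_uniq.
    have [|j ji Hj] := Hs i; first by rewrite i0.
    exists j => // l' l'i; rewrite !nth_rcons is_ (ltn_trans l'i is_).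
    exact: Hj.
have [|s [ss us cs Hs]] := H (gn T).-1; first by lia.
exists s; split=> // x; apply: contraT => xs.
have := max_card (mem (x :: s)); rewrite card_ord (card_uniqP _) /= ?xs //.
by rewrite ss; lia.
Qed.

Lemma rtd_of_tw_le (G : graph) k : tw_le G k ->
  exists m par B tp, @rtd G m par B tp k.
Proof.
case=> T [Bt [[treeT cov cove cvx] sz]].
have T0 : 0 < gn T by case: treeT.
pose x0 := Ordinal T0.
have [s [us alls Hs]] := tree_numbering x0 treeT.
have iltn t : index t s < size s by rewrite index_mem.
(* The first neighbour in the list is the unique earlier one given by the numbering. *)
pose par i := if 0 < i < size s
  then find (fun x => edge x (nth x0 s i)) s else 0.
have parE i l : l < i -> i < size s -> edge (nth x0 s l) (nth x0 s i) -> par i = l.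
  move=> li is_ e; have i0 : 0 < i < size s by rewrite is_ andbT; lia.
  have [j ji Hj] := Hs i i0; rewrite /par i0.
  move: (e); rewrite Hj // => /eqP ->.
  have hs : has (fun x => edge x (nth x0 s i)) s.
    by apply/hasP; exists (nth x0 s l) => //; rewrite mem_nth //; lia.
  set f := find _ s.
  have fj : f <= j.
    rewrite leqNgt; apply/negP => /(before_find x0) /=.
    by rewrite Hj // eqxx.
  by have := nth_find x0 hs; rewrite -/f /= Hj; [move/eqP | lia].
have parP i : par i <= i.-1.
  rewrite /par; case: ifP => // i0; have [j ji Hj] := Hs i i0.
  suff : find (fun x => edge x (nth x0 s i)) s <= j by lia.
  rewrite leqNgt; apply/negP => /(before_find x0) /=.
  by rewrite Hj // eqxx.
pose B i := if i < size s then Bt (nth x0 s i) else set0.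
have hast v : has (fun t => v \in Bt t) s.
  by have [t vt] := cov v; apply/hasP; exists t.
exists (size s), par, B, (fun v => find (fun t => v \in Bt t) s); split=> //.
- by move=> i v; rewrite /B; case: ifP => //; rewrite inE.
- by move=> v; rewrite /B -has_find hast; exact: (nth_find x0 (hast v)).
- move=> v w /cove [t vt]; exists (index t s).
  by rewrite /B iltn nth_index.
- move=> v i; rewrite {1}/B; case: ifP => [is_ vi|_]; last by rewrite inE.
  set j := find _ s; have js : j < size s by rewrite /j -has_find.
  have vj : v \in Bt (nth x0 s j) := nth_find x0 (hast v).
  have ji : j <= i by rewrite leqNgt; apply/negP => /(before_find x0) /=; rewrite vi.
  case: (eqVneq i j) => [|ij]; [by left | right]; have i0 : 0 < i by lia.
  split=> //; apply: contraT => nvp.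
  (* If the bag of [par i] misses [v], a walk through bags containing [v] cannot leave the subtree
     of [i]; yet it leads to the first such bag [j], which precedes [i]. *)
  have key a b : edge a b -> v \in Bt a -> v \in Bt b ->
      anc par i (index a s) -> anc par i (index b s).
    move=> e va vb ia.
    have ab : index a s != index b s.
      apply/negP => /eqP ab; move: e.
      by rewrite -(nth_index x0 (alls a)) -(nth_index x0 (alls b)) ab edge_irrefl.
    case: (ltnP (index a s) (index b s)) => lab.
      rewrite -(parE _ _ lab (iltn b)) ?nth_index // in ia.
      exact: (anc_trans parP ia (anc_par parP _)).
    have lba : index b s < index a s by lia.
    have pE : par (index a s) = index b s by apply: parE; rewrite ?nth_index // edge_sym.
    case/(anc_parE parP): ia => [ia|]; last by rewrite pE.
    by move: nvp; rewrite /B ia pE iltn nth_index // vb.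
  have : anc par i (index (nth x0 s j) s).
    have := cvx v _ _ vi vj; case/connectP => p pp ->.
    have : anc par i (index (nth x0 s i) s) by rewrite index_uniq // (anc_refl parP).
    elim: p (nth x0 s i) pp => //= y p IH a /andP [/and3P [e va vy]] pp ia.
    by apply: IH pp _; apply: key ia.
  rewrite index_uniq // => /(anc_le parP); lia.
- by move=> i; rewrite /B; case: ifP => // _; rewrite cards0.
Qed.

Lemma tw_le_of_rtd (G : graph) m par B tp k : 0 < m -> @rtd G m par B tp k ->
  tw_le G k.
Proof.
move=> m0 R; have parP := rtd_par R.
pose T := @Graph m (fun a b : 'I_m => (0 < a) && (b == par a :> nat)).
have edgeT (a b : 'I_m) : b < a -> @edge T a b -> b = par a :> nat.
  move=> ba /andP [_ /orP [] /= /andP [b0 /eqP //]].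
  by move=> aE; have := parP b; lia.
have edge_par (a b : 'I_m) : 0 < a -> b = par a :> nat -> @edge T a b.
  move=> a0 bE; rewrite /edge /= a0 bE eqxx orTb andbT.
  by apply/eqP => ab; have := parP a; rewrite -bE -ab; lia.
exists T, (fun t : 'I_m => B t); split; last by move=> t; apply: (rtd_size R).
split.
- split=> //.
    have to0 (a : 'I_m) : connect (@edge T) a (Ordinal m0).
      case: a; elim/ltn_ind => a IH am.
      case: (posnP a) => [a0|a0].
        by rewrite (_ : Ordinal am = Ordinal m0) ?connect0 //; apply: val_inj.
      have pa : par a < a by have := parP a; lia.
      apply: connect_trans (IH _ pa (ltn_trans pa am)).
      by apply/connect1/edge_par.
    move=> a b; apply: connect_trans (to0 a) _.
    by rewrite (sym_connect_sym (@edge_sym T)).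
  case=> x [s [us ss ps le]].
  have cyc : cycle (@edge T) (x :: s) by rewrite /= rcons_path ps.
  (* On a cycle, both neighbours of the largest node would be its parent, hence equal. *)
  have [y ys ymax] : exists2 y, y \in x :: s & forall z, z \in x :: s -> (z : 'I_m) <= y.
    have xs : x \in x :: s by rewrite mem_head.
    by case: (arg_maxnP (fun z : 'I_m => z : nat) xs) => y; exists y.
  have [i s' rotE] := rot_to ys.
  have us' : uniq (y :: s') by rewrite -rotE rot_uniq.
  have cs' : cycle (@edge T) (y :: s') by rewrite -rotE rot_cycle.
  have ss' : size s' = size s by have := size_rot i (x :: s); rewrite rotE => -[].
  have lty (z : 'I_m) : z \in s' -> z < y.
    move=> zs'; rewrite ltn_neqAle ymax; last by rewrite -(mem_rot i) rotE inE zs' orbT.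
    rewrite andbT; apply/negP => /eqP /val_inj zy.
    by rewrite zy in zs'; move: us'; rewrite /= zs'.
  case: s' rotE us' cs' ss' lty => [|z [|w s']] _ us' cs' ss' lty;
    [by rewrite -ss' in ss | by rewrite -ss' in ss |].
  move: cs'; rewrite (lastI w s') -lastI /= rcons_path => /and3P [yz _ /andP [_ ly]].
  have zE : z = par y :> nat by apply: edgeT => //; apply: lty; rewrite mem_head.
  have lE : last w s' = par y :> nat.
    by apply: edgeT; [apply: lty; rewrite inE mem_last orbT | rewrite edge_sym].
  have zl : z = last w s' by apply: val_inj; rewrite /= zE.
  by move: us'; rewrite /= zl mem_last /= andbF.
- by move=> v; exists (Ordinal (rtd_lt R (rtd_tp R v))); apply: (rtd_tp R).
- move=> v w /(rtd_edge R) [i /andP [vi wi]].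
  by exists (Ordinal (rtd_lt R vi)); rewrite vi.
- move=> v.
  set e := fun a b => _.
  have esym : connect_sym e.
    by apply: sym_connect_sym => a b; rewrite /e edge_sym; congr andb; apply: andbC.
  have to_tp (a : 'I_m) : v \in B a -> connect e a (Ordinal (rtd_lt R (rtd_tp R v))).
    case: a; elim/ltn_ind => a IH am /= va.
    case: (rtd_up R va) => [aE|[a0 vp]].
      rewrite (_ : Ordinal am = Ordinal (rtd_lt R (rtd_tp R v))) ?connect0 //.
      exact: val_inj.
    have pa : par a < a by have := parP a; lia.
    apply: connect_trans (IH _ pa (ltn_trans pa am) vp).
    by apply: connect1; rewrite /e edge_par //= va.
  move=> t1 t2 /to_tp c1 /to_tp c2; apply: connect_trans c1 _.
  by rewrite esym.
Qed.

(** * Subdividing an edge *)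

Section Subdivide.

Variables (G : graph) (u v : 'I_(gn G)).

Definition old_vertex (a : 'I_(gn G)) : 'I_(gn (subdivide u v)) := lift ord_max a.
Definition new_vertex : 'I_(gn (subdivide u v)) := ord_max.

Lemma old_vertex_inj : injective old_vertex.
Proof. exact: lift_inj. Qed.

Lemma old_vertex_val a : old_vertex a = a :> nat.
Proof. exact: lift_max. Qed.

Lemma old_vertex_new a : (old_vertex a == new_vertex) = false.
Proof. by rewrite eq_sym; apply/negbTE/neq_lift. Qed.

Variant subdivide_vertex_spec : 'I_(gn (subdivide u v)) -> Type :=
| OldVertex a : subdivide_vertex_spec (old_vertex a)
| NewVertex : subdivide_vertex_spec new_vertex.

Lemma subdivide_vertexP x : subdivide_vertex_spec x.
Proof. by case: (unliftP ord_max x) => [a|] ->; constructor. Qed.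

Lemma nedgeE (a b : 'I_(gn G)) : nedge G a b = edge a b.
Proof. by rewrite /nedge !valK. Qed.

Lemma edge_old_old a b : edge (old_vertex a) (old_vertex b) =
  edge a b && ~~ (((a == u) && (b == v)) || ((a == v) && (b == u))).
Proof.
rewrite /edge (inj_eq old_vertex_inj) /= -!/(bump _ _).
have E (c : 'I_(gn G)) : bump (gn G) c = c by rewrite -[RHS](lift_max c).
rewrite !E !ltn_ord /= !nedgeE !val_eqE [edge b a]edge_sym.
rewrite [((b == u) && _) || _]orbC [(b == v) && _]andbC [(b == u) && _]andbC orbb.
by rewrite /edge -andbA andbA andbb andbA.
Qed.

Lemma edge_old_new a : edge (old_vertex a) new_vertex = (a == u) || (a == v).
Proof.
rewrite /edge old_vertex_new /=.
have -> : bump (gn G) a = a by rewrite -[RHS](lift_max a).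
by rewrite ltnn andbF eqxx /= !val_eqE (ltn_eqF (ltn_ord a)) /= orbF orbb.
Qed.

End Subdivide.

(** A new leaf [m], with the bag of [u], [v] and the new vertex, is hung below a node whose bag
    contains [u] and [v]; [2 <= k] leaves room for these three vertices. *)
Lemma rtd_subdivide (G : graph) (u v : 'I_(gn G)) m par B tp k :
  2 <= k -> edge u v -> @rtd G m par B tp k ->
  exists m par B tp, @rtd (subdivide u v) m par B tp k.
Proof.
move=> k2 euv R; have parP := rtd_par R.
have [i0 /andP [ui vi]] := rtd_edge R euv; have i0m := rtd_lt R ui.
pose W := @old_vertex _ u v; pose N := new_vertex u v.
pose B' i := if i < m then W @: B i else if i == m then [set W u; W v; N] else set0.
pose tp' x := if unlift ord_max x is Some a then tp a else m.
have WB a i : i < m -> (W a \in B' i) = (a \in B i).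
  by move=> im; rewrite /B' im mem_imset //; apply: old_vertex_inj.
have Wm a : (W a \in B' m) = (a == u) || (a == v).
  by rewrite /B' ltnn eqxx !inE !(inj_eq (@old_vertex_inj _ u v)) old_vertex_new orbF.
have Nm i : (N \in B' i) = (i == m).
  rewrite /B'; case: ifP => im.
    rewrite (ltn_eqF im); apply/imsetP => -[a _ NW].
    by have := old_vertex_new u v a; rewrite -/W -NW eqxx.
  by case: eqP => _; rewrite !inE ?eqxx ?orbT.
have tW a : tp' (W a) = tp a by rewrite /tp' /W /old_vertex liftK.
have tN : tp' N = m by rewrite /tp' unlift_none.
exists m.+1, (fun i => if i < m then par i else if i == m then i0 else 0), B', tp'.
split.
- move=> i; case: ifP => // im; case: eqP => // ->; lia.
- move=> i x; rewrite /B'; case: ltnP => im; first by lia.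
  by case: eqP => [->|_]; rewrite ?inE.
- move=> x; case: (subdivide_vertexP x) => [a|]; last by rewrite tN Nm.
  by rewrite tW WB ?(rtd_lt R (rtd_tp R a)) // (rtd_tp R).
- move=> x y; case: (subdivide_vertexP x) => [a|]; case: (subdivide_vertexP y) => [b|].
  + rewrite edge_old_old => /andP [/(rtd_edge R) [i /andP [ai bi]] _].
    by exists i; rewrite !WB ?ai ?(rtd_lt R ai).
  + by rewrite edge_old_new => ab; exists m; rewrite Wm ab Nm eqxx.
  + by rewrite edge_sym edge_old_new => ab; exists m; rewrite Wm ab Nm eqxx.
  + by rewrite edge_irrefl.
- move=> x i; case: (subdivide_vertexP x) => [a|]; last first.
    by rewrite Nm tN => /eqP ->; left.
  rewrite tW; case: (ltnP i m) => im.
    rewrite WB // => ai; case: (rtd_up R ai) => [->|[i_gt0 ap]]; [by left | right].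
    by split=> //; rewrite WB // (leq_ltn_trans (parP i)) //; lia.
  have [->|im'] := eqVneq i m; last first.
    by rewrite /B' ltnNge im /= (negbTE im') inE.
  rewrite Wm => /orP ab; right; split; first by lia.
  by rewrite WB //; case: ab => /eqP ->.
- move=> i; rewrite /B'; case: ifP => _.
    by rewrite card_imset; [apply: (rtd_size R) | apply: old_vertex_inj].
  case: ifP => _; last by rewrite cards0.
  apply: leq_trans (_ : 3 <= _) => //.
  by rewrite cardsU !cards1 cards2; case: (_ == _); lia.
Qed.

(** * Labelled models of topological minors *)

Lemma connect_homo (T T' : finType) (e : rel T) (e' : rel T') (f : T -> T') :
  (forall a b, e a b -> connect e' (f a) (f b)) ->
  forall a b, connect e a b -> connect e' (f a) (f b).
Proof.
move=> H a b /connectP [p pp ->]; elim: p a pp => //= c p IH a /andP [/H ac /IH].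
exact: connect_trans.
Qed.

Lemma redge_path (G : graph) (A A' : {set 'I_(gn G)}) a p :
  path (redge A) a p -> {subset a :: p <= A'} -> path (redge A') a p.
Proof.
elim: p a => //= b p IH a /andP [/and3P [e _ _] pp] sA.
rewrite /redge e !sA ?inE ?eqxx ?orbT //=.
by apply: IH => // c cp; apply: sA; rewrite inE cp orbT.
Qed.

Definition strand (X G : graph) (g : 'I_(gn X) -> 'I_(gn G))
    (lab : 'I_(gn G) -> nat * nat) (x y : 'I_(gn X)) : {set 'I_(gn G)} :=
  [set v | [|| v == g x, v == g y | lab v == (x : nat, y : nat)]].

(* [g] gives the branch vertices; a vertex labelled [(x, y)] with [x < y] may
   only be used to join [g x] to [g y], so that the labels make the connections
   for distinct edges disjoint. *)
Definition model (X G : graph) (g : 'I_(gn X) -> 'I_(gn G))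
    (lab : 'I_(gn G) -> nat * nat) : Prop :=
  (forall x, lab (g x) = (x : nat, x : nat)) /\
  forall x y, edge x y -> x < y -> connect (redge (strand g lab x y)) (g x) (g y).

Lemma model_inj (X G : graph) g lab : @model X G g lab -> injective g.
Proof. by case=> L _ x y /(congr1 lab); rewrite !L => -[/val_inj]. Qed.

Lemma model_of_subdivision (X S : graph) : subdivision X S ->
  exists g lab, @model X S g lab.
Proof.
elim=> [|{}S u v _ [g [lab [L M]]] euv].
  exists id, (fun v => (v : nat, v : nat)); split=> // x y e _.
  by apply: connect1; rewrite /redge e !inE !eqxx orbT.
have uv : u != v by case/andP: euv.
(* Two distinct vertices of the strand of [x < y] have different labels among [(x, x)], [(x, y)],
   [(y, y)] or both have [(x, y)]; in each case this formula gives [(x, y)]. *)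
pose labn := (minn (lab u).1 (lab v).1, maxn (lab u).2 (lab v).2).
pose lab' (x : 'I_(gn (subdivide u v))) :=
  if unlift ord_max x is Some a then lab a else labn.
have lW a : lab' (old_vertex u v a) = lab a by rewrite /lab' /old_vertex liftK.
have lN : lab' (new_vertex u v) = labn by rewrite /lab' unlift_none.
exists (old_vertex u v \o g), lab'; split=> [x|x y e xy]; first by rewrite lW L.
apply: connect_homo (M x y e xy) => a b /and3P [eab aA bA].
have W c : c \in strand g lab x y ->
    old_vertex u v c \in strand (old_vertex u v \o g) lab' x y.
  by rewrite !inE !(inj_eq (@old_vertex_inj _ u v)) lW.
case h: (((a == u) && (b == v)) || ((a == v) && (b == u))); last first.
  by apply: connect1; rewrite /redge edge_old_old eab h !W.
have NA : new_vertex u v \in strand (old_vertex u v \o g) lab' x y.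
  have uA : u \in strand g lab x y.
    by case/orP: h => /andP [/eqP ha /eqP hb]; [rewrite -ha | rewrite -hb].
  have vA : v \in strand g lab x y.
    by case/orP: h => /andP [/eqP ha /eqP hb]; [rewrite -hb | rewrite -ha].
  rewrite inE lN /labn; apply/orP; right; apply/orP; right.
  move: uA vA uv; rewrite !inE.
  case/or3P => /eqP uE; case/or3P => /eqP vE; rewrite ?uE ?vE ?L ?eqxx //= => _;
    rewrite xpair_eqE; lia.
have H c : c \in strand g lab x y -> (c == u) || (c == v) ->
    redge (strand (old_vertex u v \o g) lab' x y) (old_vertex u v c) (new_vertex u v).
  by move=> cA cuv; rewrite /redge edge_old_new cuv W.
apply: connect_trans (connect1 (H a aA _)) _.
  by case/orP: h => /andP [-> _]; rewrite ?orbT.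
rewrite redge_csym; apply/connect1/H => //.
by case/orP: h => /andP [_ ->]; rewrite ?orbT.
Qed.

(** Induction on the number of vertices with an off-diagonal label. If an edge of [S] is not
    realised by an edge of [G], it is subdivided, and the first inner vertex of a path realising it
    becomes the image of the new vertex. *)
Lemma top_minor_of_model (X G : graph) g lab : @model X G g lab -> top_minor X G.
Proof.
suff H : forall n (S : graph) g lab, #|[set v | (lab v).1 != (lab v).2]| < n ->
    subdivision X S -> @model S G g lab -> top_minor X G.
  by apply: H (ltnSn _) (subdivision_refl X).
move=> {g lab}; elim=> // n IH S g lab; rewrite ltnS => cn sXS [L M].
case: (pickP (fun q : 'I_(gn S) * 'I_(gn S) =>
    [&& q.1 < q.2, edge q.1 q.2 & ~~ edge (g q.1) (g q.2)])) => [[x y] /= /and3P [xy e ne]|all_e].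
  have /connectP [q0 pq0 lq0] := M _ _ e xy.
  case/shortenP: pq0 lq0 => -[|a p] pq uq _ lq.
    by move/(model_inj (conj L M)): lq xy => ->; rewrite ltnn.
  move: pq uq => /= /andP [/and3P [ea _ aA] pp] /andP [gxn /andP [an up]].
  have labx z : lab (g z) == (x : nat, y : nat) = false.
    by rewrite L xpair_eqE; apply/negP => /andP [/eqP zx /eqP zy]; lia.
  have la : lab a == (x : nat, y : nat).
    move: aA; rewrite inE => /or3P [/eqP ax|/eqP ay|//].
      by rewrite ax edge_irrefl in ea.
    by rewrite -ay ea in ne.
  have ga z : (g z == a) = false by apply/negP => /eqP za; rewrite -za labx in la.
  (* [N] is the number of the new vertex. The rest of the path now serves the edge from [y] to it,
     whence the label [(y, N)] in place of [(x, y)]. *)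
  pose N := gn S.
  pose lab' w := if w == a then (N, N)
    else if (w \in p) && (lab w == (x : nat, y : nat)) then (y : nat, N) else lab w.
  pose g' (z : 'I_(gn (subdivide x y))) := if unlift ord_max z is Some z' then g z' else a.
  have gW z : g' (old_vertex x y z) = g z by rewrite /g' /old_vertex liftK.
  have gN : g' (new_vertex x y) = a by rewrite /g' unlift_none.
  apply: (IH _ g' lab') (subdivision_step sXS e) _.
    apply: leq_trans cn; apply: proper_card; apply/properP; split.
      apply/subsetP => w; rewrite !inE /lab'; case: (w =P a) => [_|_]; first by rewrite /= eqxx.
      case: ifP => // /andP [_ /eqP ->] _ /=; apply/eqP; lia.
    exists a; rewrite !inE /lab' ?eqxx //=.
    by rewrite (eqP la) /=; apply/eqP; lia.
  have lg z : lab' (g z) = (z : nat, z : nat) by rewrite /lab' ga labx andbF L.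
  split=> [z|z t].
    by case: (subdivide_vertexP z) => [z'|]; rewrite ?gW ?gN ?lg ?old_vertex_val // /lab' eqxx.
  case: (subdivide_vertexP z) => [i|]; case: (subdivide_vertexP t) => [j|].
  - rewrite edge_old_old !old_vertex_val !gW => /andP [eij nij] ij.
    apply: redgeS (M i j eij ij); apply/subsetP => w; rewrite !inE !gW !old_vertex_val.
    case/or3P => [->|->|lw]; rewrite ?orbT //.
    have nlw : lab w != (x : nat, y : nat).
      apply: contra nij => /eqP lw'; move: lw.
      rewrite lw' xpair_eqE !val_eqE => /andP [/eqP -> /eqP ->].
      by rewrite !eqxx.
    have wa : w != a by apply: contraNneq nlw => ->.
    by rewrite /lab' (negbTE wa) (negbTE nlw) andbF lw !orbT.
  - rewrite edge_old_new gW gN => /orP [] /eqP -> _.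
      by apply: connect1; rewrite /redge ea !inE gW gN !eqxx orbT.
    rewrite redge_csym; apply/connectP; exists p => //; apply: (redge_path pp) => w wap.
    rewrite inE gW gN; move: wap; rewrite inE => /predU1P [->|wp]; first by rewrite eqxx orbT.
    have wa : w != a by apply: contraNneq an => <-.
    have wx : w != g x by apply: contraNneq gxn => <-; rewrite inE wp orbT.
    have : w \in strand g lab x y.
      elim: (p) (a) pp wp => //= b p' IHp c /andP [/and3P [_ _ bA] pp'].
      by rewrite inE => /predU1P [->//|]; apply: IHp pp'.
    rewrite inE (negbTE wx) /= => /orP [->//|lw].
    by rewrite /lab' (negbTE wa) wp lw /= [bump _ _](lift_max y) eqxx !orbT.
  - by move=> _; rewrite old_vertex_val ltnNge ltnW.
  - by rewrite edge_irrefl.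
exists S; split=> //; exists g; split; first exact: model_inj (conj L M).
move=> x y e; apply: contraT => ne.
case: (ltngtP x y) => xy.
- by have := all_e (x, y); rewrite /= xy e ne.
- by have := all_e (y, x); rewrite /= xy edge_sym e edge_sym ne.
- by move: e; rewrite (val_inj xy) edge_irrefl.
Qed.

(** * Topological minors from disjoint connected sets with common neighbours *)

Definition nbrs (G : graph) (A : {set 'I_(gn G)}) : {set 'I_(gn G)} :=
  [set v | [exists a in A, edge v a]].

Lemma nbrsP (G : graph) (A : {set 'I_(gn G)}) v :
  reflect (exists2 a, a \in A & edge v a) (v \in nbrs A).
Proof. by rewrite inE; apply: exists_inP. Qed.

Lemma nbrsS (G : graph) (A A' : {set 'I_(gn G)}) : A \subset A' -> nbrs A \subset nbrs A'.
Proof.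
move=> sA; apply/subsetP => v /nbrsP [a aA e]; apply/nbrsP; exists a => //.
exact: (subsetP sA).
Qed.

Lemma pigeonhole (T : Type) (F : finType) (f : T -> F) (P : {set F}) e (s : seq T) :
  all (fun a => f a \in P) s -> #|P| * e < size s ->
  exists2 x, x \in P & e < count (fun a => f a == x) s.
Proof.
move=> sP; have -> : size s = \sum_(x in P) count (fun a => f a == x) s.
  elim: s sP => [_|a s IH /= /andP [aP /IH ->]]; first by rewrite big1.
  have one : \sum_(x in P) (f a == x) = 1.
    rewrite (bigD1 (f a)) // eqxx big1 // => x /andP [_].
    by rewrite eq_sym => /negbTE ->.
  by rewrite big_split /= one add1n.
rewrite ltnNge => H; apply/exists_inP; apply: contraR H => /exists_inPn H.
rewrite -sum_nat_const; apply: leq_sum => x /H.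
by rewrite -leqNgt.
Qed.

(** Branch vertices are taken in [P], and each ordered pair of them receives its own member of [s],
    which joins the two since both are neighbours of it. *)
Lemma top_minor_of_common_nbrs (X G : graph) (P D : {set 'I_(gn G)})
    (s : seq {set 'I_(gn G)}) :
  gn X <= #|P| -> gn X * gn X <= size s -> [disjoint P & D] ->
  (forall A, A \in s -> [/\ conn A, A \subset D & P \subset nbrs A]) ->
  pairwise (fun A A' : {set 'I_(gn G)} => [disjoint A & A']) s ->
  top_minor X G.
Proof.
move=> pP ps dPD sA ds; set p := gn X in pP ps *.
pose h (x : 'I_p) : 'I_(gn G) := enum_val (widen_ord pP x).
have hP x : h x \in P by apply: enum_valP.
have hinj : injective h by move=> x y /enum_val_inj /(congr1 val) /= /val_inj.
pose A_ (q : 'I_p * 'I_p) := nth set0 s (enum_rank q).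
have cpp : #|{: 'I_p * 'I_p}| = p * p by rewrite card_prod card_ord.
have rk (q : 'I_p * 'I_p) : enum_rank q < size s.
  by apply: leq_trans ps; rewrite -cpp; apply: ltn_ord.
have A_s q : A_ q \in s by rewrite mem_nth.
have A_inj q q' v : v \in A_ q -> v \in A_ q' -> q = q'.
  move=> vq vq'; apply/enum_rank_inj/val_inj; move/(pairwiseP set0): ds => ds.
  case: (ltngtP (enum_rank q) (enum_rank q')) => // lt.
    by have := ds _ _ (rk q) (rk q') lt; move/disjointFr/(_ vq); rewrite vq'.
  by have := ds _ _ (rk q') (rk q) lt; move/disjointFr/(_ vq'); rewrite vq.
(* The default [(0, 0)] reserves a vertex for no edge. *)
pose lab v : nat * nat := if [pick x | h x == v] is Some x then (x : nat, x : nat)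
  else if [pick q | v \in A_ q] is Some q then (q.1 : nat, q.2 : nat) else (0, 0).
apply: (@top_minor_of_model X G h lab); split=> [x|x y e xy].
  by rewrite /lab; case: pickP => [z /eqP /hinj ->//|/(_ x)]; rewrite eqxx.
have [cA AD /subsetP PA] := sA _ (A_s (x, y)).
have AS : A_ (x, y) \subset strand h lab x y.
  apply/subsetP => v vA; rewrite inE; apply/orP; right; apply/orP; right.
  rewrite /lab; case: pickP => [z /eqP hz|_].
    by have := disjointFr dPD (hP z); rewrite hz (subsetP AD).
  case: pickP => [q vq|/(_ (x, y))]; last by rewrite vA.
  by rewrite (A_inj _ _ _ vq vA).
have /nbrsP [a aA ea] := PA _ (hP x); have /nbrsP [b bA eb] := PA _ (hP y).
have ab := redgeS AS (connP _ cA a b aA bA).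
apply: connect_trans (connect_trans (connect1 _) ab) (connect1 _).
  by rewrite /redge ea (subsetP AS _ aA) inE eqxx.
by rewrite /redge edge_sym eb (subsetP AS _ bA) inE eqxx orbT.
Qed.

(** Otherwise [erdos_posa] yields more than [2 ^ w * (gn X * gn X)] disjoint connected sets in [D],
    each seeing at least [gn X] vertices of [W]. As [W] has at most [2 ^ w] subsets, more than
    [gn X * gn X] of these sets see the same one, which produces [X]. *)
Lemma hitting_nodes (X G : graph) m par B tp k (D W : {set 'I_(gn G)}) w :
  @rtd G m par B tp k -> ~ top_minor X G -> [disjoint W & D] -> #|W| <= w ->
  exists M : seq nat, size M <= 2 ^ w * (gn X * gn X) /\
    forall A, conn A -> A != set0 -> A \subset D ->
      (forall i, i \in M -> ~~ touches B A i) -> #|nbrs A :&: W| < gn X.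
Proof.
move=> R nX dWD sW; set p := gn X.
pose F := [pred A | [&& conn A, A != set0, A \subset D & p <= #|nbrs A :&: W|]].
have [A /and4P [] //|[s [ss Fs ds]]|[M [sM hM]]] :=
  erdos_posa R (F := F) (2 ^ w * (p * p)).+1; last first.
  exists M; split=> // A cA nA AD offA; rewrite ltnNge; apply/negP => pA.
  have /hasP [i iM iA] : has (touches B A) M by apply: hM; rewrite /= cA nA AD.
  by have := offA _ iM; rewrite iA.
case: nX; pose f (A : {set 'I_(gn G)}) := nbrs A :&: W.
have [||P0 _ cP0] := @pigeonhole _ _ f (powerset W) (p * p) s.
- by apply/allP => A _; rewrite powersetE subsetIr.
- by rewrite card_powerset ss ltnS leq_mul2r leq_exp2l // sW orbT.
pose s' := [seq A <- s | f A == P0].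
have s'P A : A \in s' -> [/\ F A & f A = P0].
  by rewrite mem_filter => /andP [/eqP fA /(allP Fs)].
have s'0 : 0 < size s' by rewrite size_filter; apply: leq_ltn_trans cP0.
have [FA0 fA0] := s'P _ (mem_nth set0 s'0).
apply: (@top_minor_of_common_nbrs X G P0 D s').
- by rewrite -fA0; case/and4P: FA0.
- by rewrite size_filter ltnW.
- by apply: disjointWl dWD; rewrite -fA0 subsetIr.
- by move=> A /s'P [/and4P [cA _ AD _] <-]; rewrite subsetIl.
- exact: (subseq_pairwise (filter_subseq _ _)).
Qed.

(** * Building the partition one part at a time *)

(* A partition of the vertices outside [U] into parts [0 .. q-1], together with
   the bags [Bg i] of a tree decomposition of the quotient, in which [i] is the
   last element of [Bg i]. *)
Record partial_partition (G : graph) (w c z : nat) (U : {set 'I_(gn G)}) (q : nat)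
    (f : 'I_(gn G) -> nat) (par : nat -> nat) (Bg : nat -> seq nat) : Prop := {
  pp_q : 0 < q;
  pp_lt : forall v, v \notin U -> f v < q;
  pp_width : forall x, #|[set v | (v \notin U) && (f v == x)]| <= z;
  pp_par : forall i, par i <= i.-1;
  pp_le : forall i j, i < q -> j \in Bg i -> j <= i;
  pp_self : forall i, i < q -> i \in Bg i;
  pp_size : forall i, i < q -> size (Bg i) <= c.+1;
  pp_up : forall i j, i < q -> j \in Bg i -> j = i \/ 0 < i /\ j \in Bg (par i);
  pp_edge : forall v x, v \notin U -> x \notin U -> edge v x -> f v <= f x ->
    f v \in Bg (f x);
  pp_rest : forall A, conn A -> A != set0 -> A \subset U ->
    #|nbrs A :\: U| <= w /\
    exists i bs, [/\ i < q, size bs <= c, {subset bs <= Bg i} &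
      forall v, v \in nbrs A :\: U -> f v \in bs] }.

(** No vertex is placed yet; the empty part [0] provides the root of the quotient decomposition. *)
Lemma partial_partition_start (G : graph) w c z :
  partial_partition (G := G) w c z setT 1 (fun=> 0) (fun=> 0) (fun=> [:: 0]).
Proof.
split=> //.
- move=> x; rewrite (_ : [set v | _] = set0) ?cards0 //.
  by apply/setP => v; rewrite !inE.
- by move=> i j _; rewrite inE => /eqP ->.
- by case=> // i; rewrite ltnS.
- by case=> // j _; rewrite inE => /eqP ->; left.
- move=> A _ _ _; rewrite setDT cards0; split=> //.
  by exists 0, [::]; split=> // v; rewrite inE.
Qed.

(** The new part [Z] consists of the vertices of one component [D] of [U] in the bags of an
    lca-closed set of hitting nodes. Its bag adds [q] to the parts [bs] seen by [D] and hangs below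
    the node [i0], whose bag contains [bs]. *)
Lemma partial_partition_step (X G : graph) m par0 B tp k U q f par Bg :
  let w := k.+1.*2 + gn X in
  let z := (2 ^ w * (gn X * gn X)).+1 ^ 2 * k.+1 in
  @rtd G m par0 B tp k -> ~ top_minor X G ->
  @partial_partition G w (gn X) z U q f par Bg ->
  U != set0 -> exists (U' : {set 'I_(gn G)}) q' f' par' Bg', #|U'| < #|U| /\
    @partial_partition G w (gn X) z U' q' f' par' Bg'.
Proof.
move=> w z R nX S /set0Pn [u uU]; set p := gn X in w z S *.
pose D := [set b | connect (redge U) u b].
have uD : u \in D by rewrite inE connect0.
have cD : conn D := conn_component uU.
have DU : D \subset U by apply/subsetP => b; rewrite inE => /redge_in; apply.
have nD : D != set0 by apply/set0Pn; exists u.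
have D_edge a b : a \in D -> b \in U -> edge a b -> b \in D.
  move=> aD bU e; move: (aD); rewrite !inE => /connect_trans; apply; apply: connect1.
  by rewrite /redge e (subsetP DU).
have [Ww [i0 [bs [i0q sbs bsB fbs]]]] := pp_rest S cD nD DU.
pose W := nbrs D :\: U; have dWD : [disjoint W & D].
  rewrite disjoint_sym disjoint_subset; apply/subsetP => b bD.
  by rewrite !inE (subsetP DU).
have [M [sM hM]] := hitting_nodes R nX dWD Ww.
(* Adding [tp u] puts [u] into [Z], so that [U] really shrinks. *)
have [M' [sM' MM' lM']] := lca_closure R (tp u :: M).
pose Z := D :&: [set v | has (fun i => v \in B i) M'].
have uZ : u \in Z.
  by rewrite !inE connect0 /=; apply/hasP; exists (tp u); rewrite ?(rtd_tp R) ?MM' ?mem_head.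
have ZU : Z \subset U by apply: subset_trans DU; apply: subsetIl.
have cZ : #|Z| <= z.
  have le : size M' <= (2 ^ w * (p * p)).+1 ^ 2 by rewrite sM' /= -mulnn leq_mul // ltnS.
  apply: leq_trans (leq_mul le (leqnn k.+1)).
  apply: leq_trans (subset_leq_card (subsetIr _ _)) _.
  elim: (M') => [|i s IH].
    by rewrite (_ : [set v | _] = set0) ?cards0 //; apply/setP => v; rewrite !inE.
  rewrite (_ : [set v | _] = B i :|: [set v | has (fun i => v \in B i) s]).
    rewrite mulSn; apply: leq_trans (leq_card_setU _ _) _.
    by rewrite leq_add // (rtd_size R).
  by apply/setP => v; rewrite !inE.
pose U' := U :\: Z; pose f' v := if v \in Z then q else f v.
pose par' i := if i == q then i0 else par i.
pose Bg' i := if i == q then q :: bs else Bg i.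
have notU' v : (v \notin U') = (v \in Z) || (v \notin U) by rewrite inE negb_and negbK.
have ZnU v : v \notin U -> v \in Z = false.
  by move=> vU; apply: contraNF vU; apply: (subsetP ZU).
have ltq i : i < q.+1 -> i != q -> i < q by lia.
exists U', q.+1, f', par', Bg'; split.
  apply: proper_card; apply/properP; split; first exact: subsetDl.
  by exists u; rewrite // inE uZ.
split=> //.
- move=> v; rewrite notU' /f'; case: ifP => //= _ vU.
  by rewrite ltnS ltnW // (pp_lt S).
- move=> x; have [->|xq] := eqVneq x q.
    apply: leq_trans cZ; apply: subset_leq_card; apply/subsetP => v.
    rewrite inE notU' /f'; case: ifP => //= _ /andP [vU /eqP fv].
    by have := pp_lt S vU; rewrite fv ltnn.
  apply: leq_trans (pp_width S x); apply: subset_leq_card; apply/subsetP => v.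
  rewrite inE notU' /f' inE; case: ifP => //= _ /eqP qx.
  by rewrite qx eqxx in xq.
- move=> i; rewrite /par'; case: eqP => [->|_]; last exact: (pp_par S).
  by lia.
- move=> i j iq; rewrite /Bg'; case: (i =P q) => [->|/eqP niq]; last first.
    by apply: (pp_le S); apply: ltq.
  rewrite inE => /predU1P [->//|/bsB /(pp_le S i0q)]; lia.
- move=> i iq; rewrite /Bg'; case: (i =P q) => [->|/eqP niq]; first by rewrite mem_head.
  by apply: (pp_self S); apply: ltq.
- move=> i iq; rewrite /Bg'; case: (i =P q) => [_|/eqP niq]; first by rewrite /= ltnS.
  by apply: (pp_size S); apply: ltq.
- move=> i j iq; rewrite /Bg' /par'; case: (i =P q) => [->|/eqP niq].
    rewrite inE => /predU1P [->|/bsB jB]; [by left | right].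
    by rewrite (pp_q S); case: eqP => // i0E; rewrite i0E ltnn in i0q.
  have iq' := ltq _ iq niq; move/(pp_up S iq') => [|[i_gt0 jB]]; [by left | right].
  split=> //; case: eqP => // piq; have := pp_par S i; lia.
- move=> v x; rewrite !notU' /Bg' /f'.
  case vZ: (v \in Z); case xZ: (x \in Z); rewrite /= ?eqxx ?mem_head //.
  + by move=> _ xU _; have := pp_lt S xU; lia.
  + move=> vU _ e _; rewrite inE; apply/orP; right; apply: fbs.
    rewrite inE vU; apply/nbrsP; exists x => //.
    by case/setIP: xZ.
  + move=> vU xU e fle; rewrite (ltn_eqF (pp_lt S xU)).
    exact: (pp_edge S).
move=> A cA nA AU'.
have AU : A \subset U := subset_trans AU' (subsetDl _ _).
have AZ a : a \in A -> a \notin Z by move=> /(subsetP AU'); rewrite inE => /andP [].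
(* A set missing [D] has no neighbour in [Z] and keeps its old bag; one meeting [D] is contained in
   it. *)
case: (pickP [pred a in A | a \in D]) => [a0 /andP [a0A a0D]|noD]; last first.
  have sub : nbrs A :\: U' \subset nbrs A :\: U.
    apply/subsetP => v; rewrite in_setD notU' in_setD => /andP [/orP [vZ|->//] vA].
    case/nbrsP: vA => a aA e.
    have vD : v \in D by case/setIP: vZ.
    have aD := D_edge _ _ vD (subsetP AU _ aA) e.
    by have := noD a; rewrite /= aA aD.
  have [Aw [i [bs' [iq sbs' bsB' fbs']]]] := pp_rest S cA nA AU.
  split; first exact: leq_trans (subset_leq_card sub) Aw.
  exists i, bs'; split=> //; first exact: ltnW.
    by rewrite /Bg' (ltn_eqF iq).
  move=> v /(subsetP sub) vA; rewrite /f' ZnU; first exact: fbs'.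
  by case/setDP: vA.
have AD : A \subset D.
  apply/subsetP => b bA; move: a0D; rewrite !inE => /connect_trans; apply.
  by apply: (redgeS AU); apply: (connP _ cA).
have offA i : i \in M' -> ~~ touches B A i.
  move=> iM'; apply/negP => /exists_inP [a aA ai]; have /negP [] := AZ _ aA.
  by rewrite inE (subsetP AD) // inE; apply/hasP; exists i.
have Ap : #|nbrs A :&: W| < p.
  by apply: hM => // i iM; apply: offA; rewrite MM' // inE iM orbT.
have [m1 [m2 m12]] := lM' _ cA nA offA.
have AW v : v \in nbrs A -> v \notin U -> v \in W.
  by move=> vA vU; rewrite in_setD vU (subsetP (nbrsS AD)).
split.
  (* Placed neighbours of [A] are either among fewer than [gn X] vertices of [W], or in [Z] and
     hence in two bags; this is the origin of [w]. *)
  apply: leq_trans (_ : #|(nbrs A :&: W) :|: (B m1 :|: B m2)| <= _).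
    apply: subset_leq_card; apply/subsetP => v; rewrite in_setD notU' => /andP [vUZ vA].
    case/orP: vUZ => [vZ|vU]; rewrite inE; last by rewrite inE vA AW.
    apply/orP; right; case/setIP: vZ => _; rewrite inE => /hasP [i iM' vi].
    by apply: m12 iM' vi; apply/nbrsP.
  apply: leq_trans (leq_card_setU _ _) _; rewrite /w addnC leq_add ?(ltnW Ap) //.
  apply: leq_trans (leq_card_setU _ _) _.
  by rewrite -addnn leq_add // (rtd_size R).
(* One new part and fewer than [gn X] old ones: at most [gn X] in all. *)
exists q, (q :: [seq f v | v <- enum (nbrs A :&: W)]); split=> //.
- by rewrite /= size_map -cardE.
- rewrite /Bg' eqxx => j; rewrite !inE => /predU1P [->|]; first by rewrite eqxx.
  case/mapP => v; rewrite mem_enum => /setIP [_ vW] ->.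
  by rewrite fbs ?orbT.
- move=> v; rewrite in_setD notU' /f' => /andP [vUZ vA].
  case: ifP vUZ => [_ _|_ /= vU]; first by rewrite mem_head.
  by rewrite inE map_f ?orbT // mem_enum inE vA AW.
Qed.

Lemma tpw_le_of_no_top_minor (X G : graph) k : tw_le G k -> ~ top_minor X G ->
  tpw_le (gn X) G ((2 ^ (k.+1.*2 + gn X) * (gn X * gn X)).+1 ^ 2 * k.+1).
Proof.
move=> /rtd_of_tw_le [m [par0 [B [tp R]]]] nX.
set w := _ + _; set z := _ * _.
have [q [f [par [Bg S]]]] : exists q f par Bg,
    @partial_partition G w (gn X) z set0 q f par Bg.
  have : exists (U : {set 'I_(gn G)}) q f par Bg, #|U| < #|[set: 'I_(gn G)]|.+1 /\
      @partial_partition G w (gn X) z U q f par Bg.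
    by do 5!eexists; split; last exact: partial_partition_start.
  elim: (#|_|) => [|n IH] [U [q [f [par [Bg [cU S]]]]]].
    exists q, f, par, Bg; have U0 : U = set0 by apply/eqP; rewrite -cards_eq0; lia.
    by rewrite -U0.
  have [U0|U0] := eqVneq U set0; first by exists q, f, par, Bg; rewrite -U0.
  apply: IH; have [U' [q' [f' [par' [Bg' [lt S']]]]]] := partial_partition_step R nX S U0.
  by exists U', q', f', par', Bg'; split=> //; lia.
have fq v : f v < q by apply: (pp_lt S); rewrite inE.
(* The bags [Bg] define the quotient as well as its decomposition, in which the topmost bag
   containing [j] is that of [j]. *)
pose H := @Graph q (fun i j : 'I_q => (i : nat) \in Bg j).
exists H, (fun v => Ordinal (fq v)); split.
- apply: (@tw_le_of_rtd H q par
    (fun i => if i < q then [set j : 'I_q | (j : nat) \in Bg i] else set0)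
    (fun j : 'I_q => j : nat)); first exact: (pp_q S).
  split; first exact: (pp_par S).
  + by move=> i j; case: ifP => //; rewrite inE.
  + by move=> j; rewrite ltn_ord inE (pp_self S).
  + by move=> i j /andP [_ /orP [] /= e]; [exists j | exists i];
      rewrite ltn_ord !inE e (pp_self S).
  + move=> j i; case: ifP => [iq|_]; last by rewrite inE.
    rewrite inE => /(pp_up S iq) [->|[i0 jB]]; [by left | right].
    have piq : par i < q by have := pp_par S i; lia.
    by rewrite piq inE.
  + move=> i; case: ifP => [iq|_]; last by rewrite cards0.
    apply: leq_trans (pp_size S iq); rewrite cardE -(size_map val).
    apply: uniq_leq_size; first by rewrite (map_inj_uniq val_inj) enum_uniq.
    by move=> i' /mapP [j]; rewrite mem_enum inE => jB ->.
- move=> v x e; case: (eqVneq (Ordinal (fq v)) (Ordinal (fq x))) => vx; [by left | right].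
  rewrite /edge vx /=; case: (leqP (f v) (f x)) => fvx.
    by rewrite (pp_edge S) ?inE.
  by rewrite (pp_edge S (v := x)) ?inE ?orbT 1?edge_sym // ltnW.
- move=> x; apply: leq_trans (pp_width S x); apply: subset_leq_card.
  by apply/subsetP => v; rewrite !inE => /eqP <- /=.
Qed.

(** * Closures of complete trees and partitions of their subdivisions *)

Section HeapClosure.

Variables N h : nat.

(* Heap numbering of the complete [N]-ary tree: the children of [i] are
   [i * N + 1 .. i * N + N], and the nodes of depth at most [d] are those below
   [heap_size d]. *)
Definition heap_par (i : nat) : nat := i.-1 %/ N.+1.
Definition heap_child (i j : nat) : nat := (i * N.+1 + j).+1.
Definition heap_size (d : nat) : nat := iter d (fun l => (N.+1 * l).+1) 1.

Lemma heap_parP i : heap_par i <= i.-1.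
Proof. exact: leq_div. Qed.

Lemma heap_childK i j : j < N.+1 -> heap_par (heap_child i j) = i.
Proof. by move=> jN; rewrite /heap_par /= divnMDl // divn_small // addn0. Qed.

Lemma heap_child_lt i j d :
  i < heap_size d -> j < N.+1 -> heap_child i j < heap_size d.+1.
Proof. by rewrite /heap_child /=; nia. Qed.

Lemma heap_size_le d e : d <= e -> heap_size d <= heap_size e.
Proof.
move/subnK <-; elim: (e - d) => // n IH.
by rewrite addSn; apply: leq_trans IH _; rewrite /=; nia.
Qed.

Lemma heap_depth i d : i < heap_size d -> iter d heap_par i = 0.
Proof.
elim: d i => [|d IH] i; first by rewrite ltnS leqn0 => /eqP.
move=> /= id; rewrite -iterS iterSr IH // /heap_par ltn_divLR //.
have : 0 < heap_size d by case: (d).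
by move: (heap_size d) id => l; nia.
Qed.

Definition heap_closure : graph :=
  @Graph (heap_size h) (fun i j => anc heap_par i j).

Lemma heap_edge (i j : 'I_(heap_size h)) : i < j -> anc heap_par i j ->
  @edge heap_closure i j.
Proof.
by move=> ij a; rewrite /edge /= a andbT; apply: contraTneq ij => ->; rewrite ltnn.
Qed.

(** The bag of a node is its path to the root, which has at most [h.+1] nodes. *)
Lemma rtd_heap_closure : exists m par B tp, @rtd heap_closure m par B tp h.
Proof.
exists (heap_size h), heap_par,
  (fun i => if i < heap_size h then [set j : 'I_(heap_size h) | anc heap_par j i] else set0),
  (fun j : 'I_(heap_size h) => j : nat).
split.
- exact: heap_parP.
- by move=> i j; case: ifP => //; rewrite inE.
- by move=> j; rewrite ltn_ord inE (anc_refl heap_parP).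
- by move=> i j /andP [_ /orP [] /= e]; [exists j | exists i];
    rewrite ltn_ord !inE e (anc_refl heap_parP).
- move=> j i; case: ifP => [ih|_]; last by rewrite inE.
  rewrite inE => a; case: (posnP i) => [i0|i0].
    by left; have := anc_le heap_parP a; lia.
  case/(anc_parE heap_parP): a => [->|a]; [by left | right].
  have pih : heap_par i < heap_size h by have := heap_parP i; lia.
  by rewrite pih inE.
- move=> i; case: ifP => [ih|_]; last by rewrite cards0.
  rewrite -(size_iota 0 h.+1) -(size_map (fun l => iter l heap_par i)).
  rewrite cardE -(size_map val).
  apply: uniq_leq_size; first by rewrite (map_inj_uniq val_inj) enum_uniq.
  move=> x /mapP [j]; rewrite mem_enum inE => /(ancP heap_parP) [l lj] ->.
  case: (leqP l h) => lh.
    by apply/mapP; exists l; rewrite // mem_iota.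
  apply/mapP; exists h; first by rewrite mem_iota leqnn.
  rewrite /= (heap_depth ih) -lj -(subnK (ltnW lh)) iterD (heap_depth ih).
  by have := iter_par_le heap_parP (l - h) 0; lia.
Qed.

Variables (S H : graph) (g : 'I_(gn heap_closure) -> 'I_(gn S)).
Variables (lab : 'I_(gn S) -> nat * nat) (p : 'I_(gn S) -> 'I_(gn H)) (c z : nat).
Hypothesis gM : model g lab.
Hypothesis pP : H_partition p.
Hypothesis pz : partition_width_le p z.
Hypothesis hE : h = c.*2.+3.
Hypothesis hN : h * z <= N.

(** The parts in [Y] contain at most [h * z <= N] vertices, each spoiling at most one of the [N.+1]
    children. For a free child, neither its branch vertex nor the inner vertices of the strands from
    its ancestors lie in parts of [Y]. *)
Lemma free_child (Y : {set 'I_(gn H)}) i : #|Y| <= h -> exists2 j, j < N.+1 &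
  forall v, p v \in Y -> (lab v).2 != heap_child i j.
Proof.
move=> Yh; pose Q := [set v | p v \in Y].
have cQ : #|Q| <= N.
  apply: leq_trans hN; apply: leq_trans (leq_mul Yh (leqnn z)).
  rewrite -sum1dep_card (partition_big p (mem Y)) //= -sum_nat_const.
  apply: leq_sum => y yY; apply: leq_trans (pz y); rewrite sum1dep_card.
  by apply: subset_leq_card; apply/subsetP => v; rewrite !inE => /andP [].
pose s := [seq (lab v).2 | v <- enum Q].
have [allin|] := boolP (all (fun j => heap_child i j \in s) (iota 0 N.+1)).
  have: N.+1 <= size s.
    rewrite -(size_iota 0 N.+1) -(size_map (heap_child i)).
    apply: uniq_leq_size; last by move=> x /mapP [j /(allP allin) js ->].
    by rewrite map_inj_uniq ?iota_uniq // => j j' [] /addnI.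
  by rewrite size_map -cardE ltnNge cQ.
case/allPn => j; rewrite mem_iota => /andP [_ jN] js; exists j => // v vY.
by apply: contra js => /eqP <-; apply: map_f; rewrite mem_enum inE.
Qed.

(** The walk goes down from the root, each time to a child free for the parts already used. *)
Lemma distinct_parts_chain d : d < h ->
  exists (i : 'I_(heap_size h)) (r : seq 'I_(heap_size h)),
    [/\ size r = d, i < heap_size d, uniq [seq p (g x) | x <- i :: r] &
      forall x, x \in i :: r -> anc heap_par x i].
Proof.
elim: d => [|d IH] dh.
  have h0 : 0 < heap_size h by case: (h).
  exists (Ordinal h0), [::].
  by split=> // x; rewrite inE => /eqP ->; apply: (anc_refl heap_parP).
have [i [r [sr id ur ra]]] := IH (ltnW dh).
pose Y := [set y in [seq p (g x) | x <- i :: r]].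
have [|j jN jY] := free_child (Y := Y) i.
  by rewrite cardsE; apply: leq_trans (card_size _) _; rewrite size_map /= sr; lia.
have td := heap_child_lt id jN.
have th : heap_child i j < heap_size h := leq_trans td (heap_size_le (ltnW dh)).
exists (Ordinal th), (i :: r); split=> //=; first by rewrite sr.
  rewrite -[X in _ && X]/(uniq (map (p \o g) (i :: r))) ur andbT.
  apply/negP => tY; have := jY (g (Ordinal th)).
  by rewrite (proj1 gM) /= eqxx inE => /(_ tY).
move=> x; rewrite inE => /predU1P [->|/ra xi]; first exact: (anc_refl heap_parP).
apply: (anc_trans heap_parP xi); rewrite -{1}(heap_childK i jN).
exact: (anc_par heap_parP).
Qed.

(* [h = 2c+3] vertices of the chain lie in distinct parts; the subdivided edges to
   a suitable child of the last one keep most of them connected outside any bag. *)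
Lemma heap_quotient_tw m par B tp : ~ @rtd H m par B tp c.
Proof.
(* After [h.-1] steps there are [h] nodes, and the children of the last are still in the tree. *)
move=> R; have [|i [r [sr id ur ra]]] := @distinct_parts_chain h.-1; first by lia.
pose Q := [set y in [seq p (g x) | x <- i :: r]].
have cQ : #|Q| = c.*2.+3 by rewrite cardsE (card_uniqP ur) size_map /= sr; lia.
have [|Y [cY hY]] := balanced_bag R (Q := Q); first by rewrite cQ.
have [|j jN jY] := free_child (Y := Y) i; first by lia.
have th : heap_child i j < heap_size h by have := heap_child_lt id jN; rewrite prednK //; lia.
pose t := Ordinal th : 'I_(gn heap_closure).
have tY : p (g t) \in ~: Y.
  by rewrite inE; apply/negP => /jY; rewrite (proj1 gM) eqxx.
pose C := [set x | connect (redge (~: Y)) (p (g t)) x].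
have CY : C \subset ~: Y by apply/subsetP => x; rewrite inE => /redge_in; apply.
(* [C] avoids [Y], so it must not contain [c.+2] parts of [Q]; but it contains all of [Q] outside
   [Y], at least [c.*2.+3 - c.+1] parts. *)
suff: c.+1 < #|C :&: Q| by move/(hY C (conn_component tY)); rewrite disjoints_subset CY.
have : Q :\: Y \subset C :&: Q.
  apply/subsetP => y /setDP [yQ yY]; rewrite in_setI yQ andbT.
  move: yQ; rewrite inE => /mapP [x xr yE]; rewrite yE in yY *.
  have xi := ra x xr; have xt : x < t by have := anc_le heap_parP xi; rewrite /= /heap_child; nia.
  have it : anc heap_par i t by rewrite -{1}(heap_childK i jN) (anc_par heap_parP).
  (* The strand from [x] to the free child [t] avoids [Y], so [p] maps it to a walk inside [C]. *)
  have := proj2 gM x t (heap_edge xt (anc_trans heap_parP xi it)) xt.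
  have notY a : a \in strand g lab x t -> p a \in ~: Y.
    rewrite !inE => /or3P [/eqP ->//|/eqP ->|/eqP la]; first by rewrite inE in tY.
    by apply/negP => /jY; rewrite la eqxx.
  rewrite inE redge_csym; apply: connect_homo => a b /and3P [e /notY aY /notY bY].
  case: (pP e) => [->//|e']; apply: connect1.
  by rewrite /redge e' aY.
move/subset_leq_card; rewrite cardsD cQ.
move: cY (subset_leq_card (subsetIr Q Y)); rewrite -addnn.
by move: #|Y| #|Q :&: Y| #|C :&: Q|; lia.
Qed.

End HeapClosure.

(** * Treewidth of subdivisions and the equivalence *)

Lemma rtd_subdivision (X S : graph) k : 2 <= k -> subdivision X S ->
  (exists m par B tp, @rtd X m par B tp k) -> exists m par B tp, @rtd S m par B tp k.
Proof.
move=> k2; elim=> // {}S u v _ IH e /IH [m [par [B [tp R]]]].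
exact: rtd_subdivide R.
Qed.

Theorem theorem6p5 (C : graph -> Prop) :
  monotone C ->
  (bounded_underlying_tw C <-> exists X : graph, forall G, C G -> ~ top_minor X G).
Proof.
case=> _ mono; split=> [[c [f bC]]|[X nX]]; last first.
  exists (gn X), (fun k => (2 ^ (k.+1.*2 + gn X) * (gn X * gn X)).+1 ^ 2 * k.+1).
  by move=> G /nX nXG k [/tpw_le_of_no_top_minor twG _]; apply: twG.
(* The treewidth of a subdivision is only known to be at most [h], so [z] bounds every [f k] with
   [k <= h]. *)
pose h := c.*2.+3; pose z := \sum_(k < h.+1) f k; pose N := h * z.
exists (heap_closure N h) => G CG [S [sXS sSG]].
have CS := mono _ _ CG sSG; have [g [lab gM]] := model_of_subdivision sXS.
have [m [par [B [tp R]]]] := rtd_subdivision (isT : 2 <= h) sXS (rtd_heap_closure N h).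
have h0 : 0 < heap_size N h by [].
have : tw_le S h.
  by apply: (tw_le_of_rtd _ R); apply: leq_trans (rtd_lt R (rtd_tp R (g (Ordinal h0)))).
(* Strong induction makes [k] the exact treewidth of [S], as the hypothesis on [f] requires. *)
suff H k : k <= h -> ~ tw_le S k by apply: H.
elim/ltn_ind: k => k IH kh twk.
have : is_tw S k.
  split=> // j twj; rewrite leqNgt; apply/negP => jk.
  by apply: (IH j) twj => //; lia.
move/(bC S CS) => [H [p [/rtd_of_tw_le [m' [par' [B' [tp' R']]]] pP pz]]].
apply: (heap_quotient_tw gM pP _ (erefl h) (leqnn N)) R' => x.
apply: leq_trans (pz x) _.
by rewrite /z (bigD1 (Ordinal (kh : k < h.+1))) //= leq_addr.
Qed.
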